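(* Assume that the discrete logarithm problem is hard in the elliptic-curve group $\mathbb{E}$ output by $\mathrm{Gen}(1^\lambda)$. Then the ZK-SNARK based Proof of Assets protocol (defined in the context) provides privacy of the addresses owned by the exchange. That is, for every probabilistic polynomial time (PPT) distinguisher $\mathcal{D}$ there is a negligible function $\mathrm{negl}$ such that for every $i\in\{1,\dots,n\}$, that is, for every address $y_i$ in the anonymity set $\mathbf{S_{anon}}=\{y_1,\dots,y_n\}$ with public balance $v_i$, one has $$\Pr\big[\mathrm{AddressPrivacy}^{\mathcal{D}}_{y_i,c_i}=1\big]=\Pr[b_i'=b_i]\le \tfrac12+\mathrm{negl}(\lambda),$$ where $\mathrm{AddressPrivacy}^{\mathcal{D}}_{y_i,c_i}$ is the experiment defined in the context.
   Context: **Groups and keys.** $\mathrm{Gen}(1^\lambda)$ outputs $(\mathbb{E},p,q,G,H)$. Here $\mathbb{E}$ is a group of prime order $q$ of points of an elliptic curve over $\mathbb{F}_p$, written additively, and $G,H$ are generators chosen uniformly and independently, so that the discrete logarithm of one with respect to the other is unknown. Write $\mathbb{Z}_q=\{1,\dots,q-1\}$. The discrete logarithm assumption says that no PPT algorithm, given the public parameters, computes the discrete logarithm of a random element of $\mathbb{E}$ (in particular, the $k$ with $G=kH$) except with negligible probability in $\lambda$. A Bitcoin address (public key) is $y=xG\in\mathbb{E}$ with private key $x\in\mathbb{Z}_q$. The exchange $\mathcal{E}$ publishes an anonymity set $\mathbf{S_{anon}}=\{y_1,\dots,y_n\}\subset\mathbb{E}$ containing the set $\mathbf{S_{own}}$ of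 addresses whose private keys it knows. Each $y_i$ has a public balance $v_i$, a nonnegative integer less than $2^{51}$. **Relation.** The public input is $z_i=(y_i,v_i)$, the witness is $w_i=(x_i,s_i,r_i)$, and the circuit output is the Pedersen commitment $c_i$. We have $(z_i,w_i)\in\mathcal{R}_{PoA}$ with output $c_i$ iff all of the following hold: $s_i\in\{0,1\}$; $s_i=1$ if $x_iG=y_i$ and $s_i=0$ if $x_iG\ne y_i$; and $c_i=s_iv_iG+r_iH$. This is expressed by an arithmetic circuit $C_{PoA}$ over $\mathbb{F}_p$ and by a corresponding quadratic arithmetic program $(\{u_j\}_{j=0}^m,\{v_j\}_{j=0}^m,\{w_j\}_{j=0}^m,t)$ over $\mathbb{F}_p$, with $\deg t=N$ and all other polynomials of degree at most $N-1$. An assignment $(a_0=1,a_1,\dots,a_m)$ is valid iff $t(X)$ divides $\big(\sum_j a_ju_j(X)\big)\big(\sum_j a_jv_j(X)\big)-\sum_j a_jw_j(X)$; the quotient is denoted $h(X)$. The values $a_0,\dots,a_l$ encode the public data, and $a_{l+1},\dots,a_m$ encode the witness and the internal wires. **ZK-SNARK (Groth's construction).** Let $\mathbb{G}_1,\mathbb{G}_2,\mathbb{G}_T$ be groups of prime order $p$ with a bilinear pairing, and let $[a]_1,[a]_2$ denote the encodings of $a\in\mathbb{F}_p$ in $\mathbb{G}_1,\mathbb{G}_2$. - Setup, run by a trusted third party: pick $\alpha,\beta,\gamma,\delta,x\leftarrow\mathbb{F}_p^*$ uniformly and output $\sigma=([\sigma_1]_1,[\sigma_2]_2)$, where $\sigma_1$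 consists of $\alpha,\beta,\delta$, $\{x^j\}_{j=0}^{N-1}$, $\{(\beta u_j(x)+\alpha v_j(x)+w_j(x))/\gamma\}_{j=0}^{l}$, $\{(\beta u_j(x)+\alpha v_j(x)+w_j(x))/\delta\}_{j=l+1}^{m}$, $\{x^jt(x)/\delta\}_{j=0}^{N-2}$, and $\sigma_2$ consists of $\beta,\gamma,\delta,\{x^j\}_{j=0}^{N-1}$. - Prove: pick $\rho,\theta\leftarrow\mathbb{F}_p^*$ uniformly and output $\pi=([A]_1,[B]_2,[C]_1)$ with $A=\alpha+\sum_{j=0}^m a_ju_j(x)+\rho\delta$, $B=\beta+\sum_{j=0}^m a_jv_j(x)+\theta\delta$, $C=\frac{\sum_{j=l+1}^m a_j(\beta u_j(x)+\alpha v_j(x)+w_j(x))+h(x)t(x)}{\delta}+A\theta+B\rho-\rho\theta\delta$. - Verify: accept iff $[A]_1\cdot[B]_2=[\alpha]_1\cdot[\beta]_2+\sum_{j=0}^{l}a_j\big[\tfrac{\beta u_j(x)+\alpha v_j(x)+w_j(x)}{\gamma}\big]_1\cdot[\gamma]_2+[C]_1\cdot[\delta]_2$, where $\cdot$ is the pairing. In the Proof of Assets protocol the exchange gives, for each $i$, the commitment $c_i=s_iv_iG+r_iH$ with $r_i\leftarrow\mathbb{Z}_q$ uniform, together with the proof $\pi_i$ produced by Prove. It also gives $C_{Assets}=\sum_{i=1}^n c_i$. **Experiment $\mathrm{AddressPrivacy}^{\mathcal{D}}_{y_i,c_i}$** (for a single instance $z_i=(y_i,v_i)$): 1. Generate the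 public parameters $(\mathbb{E},p,q,G,H)\leftarrow\mathrm{Gen}(1^\lambda)$ (and the common reference string $\sigma$ by Setup). 2. $\mathcal{E}$ picks $b_i\leftarrow\{0,1\}$ uniformly. 3. $\mathcal{E}$ picks $r_i\leftarrow\mathbb{Z}_q$ uniformly, computes $c_i=b_iv_iG+r_iH$, and computes the ZK-SNARK proof $\pi_i$ for $(z_i,w_i)\in\mathcal{R}_{PoA}$ with output $c_i$, where $w_i=(x_i,s_i,r_i)$ has $s_i=b_i$ (so $x_iG=y_i$ if $b_i=1$, and $x_iG\neq y_i$ if $b_i=0$). 4. $\mathcal{D}$ receives $(z_i,c_i,\pi_i)$ and outputs $b_i'=\mathcal{D}(z_i,c_i,\pi_i)\in\{0,1\}$. 5. The experiment outputs $1$ ($\mathcal{D}$ succeeds) if $b_i'=b_i$, and $0$ otherwise. *)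

(* Defs.v *)
From HB Require Import structures.
From mathcomp Require Import all_boot all_order all_algebra.
From mathcomp Require Import reals.

Set Implicit Arguments.
Unset Strict Implicit.
Unset Printing Implicit Defensive.

Import Order.TTheory GRing.Theory Num.Theory.
Local Open Scope ring_scope.

(** * Finite probability distributions and negligible functions *)

(* A distribution with finite support, as a list of (weight, outcome) pairs;
   an outcome may occur several times, its weights then add up.  A list rather
   than a function on a [finType] because outcomes may be group descriptions. *)
Definition fdist (R : realType) (T : Type) : Type := seq (R * T).

Definition is_dist (R : realType) (T : Type) (d : fdist R T) : Prop :=
  all (fun wx => 0 <= wx.1) d /\ \sum_(wx <- d) wx.1 = 1.

Definition dret (R : realType) (T : Type) (x : T) : fdist R T := [:: (1, x)].

Definition dbind (R : realType) (T U : Type)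
    (d : fdist R T) (f : T -> fdist R U) : fdist R U :=
  [seq (wx.1 * wy.1, wy.2) | wx <- d, wy <- f wx.2].

Definition dunif (R : realType) (T : finType) (A : {pred T}) : fdist R T :=
  [seq (#|A|%:R^-1, x) | x <- enum A].

Definition Pr (R : realType) (T : Type) (d : fdist R T) (P : pred T) : R :=
  \sum_(wx <- d | P wx.2) wx.1.

Notation "x <~ d ;; f" := (dbind d (fun x => f))
  (at level 100, d at level 99, f at level 200, right associativity).

Definition negligible (R : realType) (f : nat -> R) : Prop :=
  forall c : nat, exists n0 : nat, forall n : nat, (n0 <= n)%N ->
    `|f n| < (n%:R ^+ c)^-1.

(** * Probabilistic polynomial-time Turing machines *)

Inductive symbol := Blank | Sep | Bit of bool.
Inductive move := MoveL | MoveR | Stay.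

(* One two-way infinite tape; the boolean argument of [ptm_step] is a fresh
   uniform coin. *)
Record ptm := Ptm {
  ptm_state : finType;
  ptm_start : ptm_state;
  ptm_halted : pred ptm_state;
  ptm_step : ptm_state -> symbol -> bool -> ptm_state * symbol * move }.

(* [cfg_left] is listed from the head outwards; cells beyond both lists are
   blank. *)
Record config (M : ptm) := Config {
  cfg_state : ptm_state M;
  cfg_left : seq symbol;
  cfg_head : symbol;
  cfg_right : seq symbol }.

Definition ptm_init (M : ptm) (w : seq symbol) : config M :=
  Config (ptm_start M) [::] (head Blank w) (behead w).

Definition ptm_next (M : ptm) (c : config M) (coin : bool) : config M :=
  let: (q, s, m) := ptm_step (cfg_state c) (cfg_head c) coin in
  match m with
  | MoveL => Config q (behead (cfg_left c)) (head Blank (cfg_left c))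
                      (s :: cfg_right c)
  | MoveR => Config q (s :: cfg_left c) (head Blank (cfg_right c))
                      (behead (cfg_right c))
  | Stay => Config q (cfg_left c) s (cfg_right c)
  end.

Fixpoint ptm_run (M : ptm) (c : config M) (coins : seq bool) : config M :=
  if ptm_halted (cfg_state c) then c else
  if coins is b :: coins' then ptm_run (ptm_next c b) coins' else c.

Fixpoint bit_prefix (s : seq symbol) : seq bool :=
  if s is Bit b :: s' then b :: bit_prefix s' else [::].

(* The output is the bit string that starts at the head. *)
Definition ptm_output (M : ptm) (c : config M) : seq bool :=
  bit_prefix (cfg_head c :: cfg_right c).

(* Running time at most n^k + k on every input of length n, whatever the
   coins. *)
Record pptm := Pptm {
  ppt_machine :> ptm;
  ppt_exp : nat;
  ppt_halts : forall (w : seq symbol)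
      (coins : (size w ^ ppt_exp + ppt_exp).-tuple bool),
    ptm_halted (cfg_state (ptm_run (ptm_init ppt_machine w) coins)) }.

Definition ppt_exec (R : realType) (M : pptm) (w : seq symbol) :
    fdist R (seq bool) :=
  coins <~ dunif R {: (size w ^ ppt_exp M + ppt_exp M).-tuple bool} ;;
  dret R (ptm_output (ptm_run (ptm_init M w) coins)).

(** * Bit-string encodings *)

(* Least significant bit first; never empty. *)
Definition binary (n : nat) : seq bool :=
  [seq odd (n %/ 2 ^ i) | i <- iota 0 (trunc_log 2 n).+1].

Definition of_binary (s : seq bool) : nat :=
  foldr (fun (b : bool) n => b + n.*2)%N 0%N s.

Definition unary (n : nat) : seq bool := nseq n true.

Definition encode (fields : seq (seq bool)) : seq symbol :=
  flatten [seq rcons (map Bit f) Sep | f <- fields].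

Definition enc_list (T : Type) (enc : T -> seq (seq bool)) (s : seq T) :
    seq (seq bool) :=
  binary (size s) :: flatten (map enc s).

Definition enc_Fp (p : nat) (a : 'F_p) : seq (seq bool) := [:: binary a].

(** * Elliptic curve groups *)

(* y^2 + a1 x y + a3 y = x^3 + a2 x^2 + a4 x + a6, in any characteristic. *)
Record weierstrass (F : fieldType) := Weierstrass {
  wa1 : F; wa2 : F; wa3 : F; wa4 : F; wa6 : F }.

Definition disc (F : fieldType) (W : weierstrass F) : F :=
  let: Weierstrass a1 a2 a3 a4 a6 := W in
  let b2 := a1 ^+ 2 + 4 * a2 in
  let b4 := 2 * a4 + a1 * a3 in
  let b6 := a3 ^+ 2 + 4 * a6 in
  let b8 := a1 ^+ 2 * a6 + 4 * a2 * a6 - a1 * a3 * a4 + a2 * a3 ^+ 2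
            - a4 ^+ 2 in
  - b2 ^+ 2 * b8 - 8 * b4 ^+ 3 - 27 * b6 ^+ 2 + 9 * b2 * b4 * b6.

(* [None] is the point at infinity. *)
Definition on_curve (F : fieldType) (W : weierstrass F) (P : option (F * F)) :
    bool :=
  let: Weierstrass a1 a2 a3 a4 a6 := W in
  if P is Some (x, y) then
    y ^+ 2 + a1 * x * y + a3 * y == x ^+ 3 + a2 * x ^+ 2 + a4 * x + a6
  else true.

(* Chord-and-tangent law: the line through the two points (the tangent if they
   coincide) is Y = sl * X + nu. *)
Definition ec_add (F : fieldType) (W : weierstrass F)
    (P1 P2 : option (F * F)) : option (F * F) :=
  let: Weierstrass a1 a2 a3 a4 a6 := W in
  match P1, P2 with
  | None, _ => P2
  | _, None => P1
  | Some (x1, y1), Some (x2, y2) =>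
    if (x1 == x2) && (y1 + y2 + a1 * x2 + a3 == 0) then None else
    let sl := if x1 == x2
      then (3 * x1 ^+ 2 + 2 * a2 * x1 + a4 - a1 * y1) / (2 * y1 + a1 * x1 + a3)
      else (y2 - y1) / (x2 - x1) in
    let nu := y1 - sl * x1 in
    let x3 := sl ^+ 2 + a1 * sl - a2 - x1 - x2 in
    Some (x3, - (sl + a1) * x3 - nu - a3)
  end.

(* The group of points is a [finZmodType] that embeds into the curve, so that
   its addition is the chord-and-tangent law; it may be a proper subgroup of
   the full group of rational points. *)
Record ecGroup := EcGroup {
  ec_p : nat;
  ec_p_prime : prime ec_p;
  ec_curve : weierstrass 'F_ec_p;
  ec_disc : disc ec_curve != 0;
  ec_q : nat;
  ec_q_prime : prime ec_q;
  ec_E :> finZmodType;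
  ec_card : #|ec_E| = ec_q;
  ec_pt : ec_E -> option ('F_ec_p * 'F_ec_p);
  ec_pt_inj : injective ec_pt;
  ec_pt_curve : forall P : ec_E, on_curve ec_curve (ec_pt P);
  ec_pt0 : ec_pt 0 = None;
  ec_ptD : forall P Q : ec_E,
    ec_pt (P + Q) = ec_add ec_curve (ec_pt P) (ec_pt Q) }.

Definition is_generator (E : finZmodType) (P : E) : bool :=
  [forall Q : E, exists k : 'I_#|E|, Q == P *+ k].

Record pubParams := PubParams {
  pp_ec :> ecGroup;
  pp_Ggen : {P : pp_ec | is_generator P};
  pp_Hgen : {P : pp_ec | is_generator P} }.

Definition pp_G (pp : pubParams) : pp := val (pp_Ggen pp).
Definition pp_H (pp : pubParams) : pp := val (pp_Hgen pp).

Notation pp_p pp := (ec_p (pp_ec pp)).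
Notation pp_q pp := (ec_q (pp_ec pp)).

(* [GenE] samples the group description (E, p, q); the generators are then
   uniform and independent. *)
Definition genParams (R : realType) (GenE : nat -> fdist R ecGroup)
    (lam : nat) : fdist R pubParams :=
  E <~ GenE lam ;;
  G <~ dunif R {: {P : E | is_generator P}} ;;
  H <~ dunif R {: {P : E | is_generator P}} ;;
  dret R (PubParams G H).

Definition enc_point (E : ecGroup) (P : E) : seq (seq bool) :=
  if ec_pt P is Some (x, y) then enc_Fp x ++ enc_Fp y else [:: [::]; [::]].

Definition enc_params (pp : pubParams) : seq (seq bool) :=
  let: Weierstrass a1 a2 a3 a4 a6 := ec_curve pp in
  [:: binary (pp_p pp), binary (pp_q pp) &
      flatten (map (@enc_Fp (pp_p pp)) [:: a1; a2; a3; a4; a6])]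
  ++ enc_point (pp_G pp) ++ enc_point (pp_H pp).

(** * The discrete logarithm assumption *)

Definition DL_experiment (R : realType) (GenE : nat -> fdist R ecGroup)
    (A : pptm) (lam : nat) : fdist R bool :=
  pp <~ genParams GenE lam ;;
  Y <~ dunif R {: pp} ;;
  out <~ ppt_exec R A (encode (unary lam :: enc_params pp ++ enc_point Y)) ;;
  dret R (Y == pp_G pp *+ of_binary out).

Definition DL_hard (R : realType) (GenE : nat -> fdist R ecGroup) : Prop :=
  forall A : pptm, negligible (fun lam => Pr (DL_experiment GenE A lam) id).

(** * The relation R_PoA *)

Definition instance (pp : pubParams) : Type := (pp * nat)%type.

(* y is the public key of some private key in {1, ..., q - 1}. *)
Definition wf_instance (pp : pubParams) (z : instance pp) : Prop :=
  (exists x : nat, (0 < x < pp_q pp)%N /\ z.1 = pp_G pp *+ x) /\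
  (z.2 < 2 ^ 51)%N.

Record witness (pp : pubParams) := Witness {
  wit_x : 'I_(pp_q pp);
  wit_s : nat;
  wit_r : 'I_(pp_q pp) }.

Definition R_PoA (pp : pubParams) (z : instance pp) (w : witness pp) (c : pp) :
    Prop :=
  let: (y, v) := z in
  let: Witness x s r := w in
  [/\ s = 0%N \/ s = 1%N,
      pp_G pp *+ x = y -> s = 1%N,
      pp_G pp *+ x <> y -> s = 0%N &
      c = pp_G pp *+ (s * v) + pp_H pp *+ r].

(** * Quadratic arithmetic programs *)

(* Wires 0, ..., l are public; the other wires are l + 1, ..., m with
   m = l + k. *)
Record qap (F : fieldType) := Qap {
  qap_l : nat;
  qap_k : nat;
  qap_N : nat;
  qap_u : 'I_(qap_l.+1 + qap_k) -> {poly F};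
  qap_v : 'I_(qap_l.+1 + qap_k) -> {poly F};
  qap_w : 'I_(qap_l.+1 + qap_k) -> {poly F};
  qap_t : {poly F};
  qap_size_t : size qap_t = qap_N.+1;
  qap_size_u : forall j, (size (qap_u j) <= qap_N)%N;
  qap_size_v : forall j, (size (qap_v j) <= qap_N)%N;
  qap_size_w : forall j, (size (qap_w j) <= qap_N)%N }.

Definition qap_num (F : fieldType) (Q : qap F)
    (a : 'rV[F]_((qap_l Q).+1 + qap_k Q)) : {poly F} :=
  (\sum_j a 0 j *: qap_u j) * (\sum_j a 0 j *: qap_v j)
  - \sum_j a 0 j *: qap_w j.

Definition qap_valid (F : fieldType) (Q : qap F)
    (a : 'rV[F]_((qap_l Q).+1 + qap_k Q)) : Prop :=
  a 0 ord0 = 1 /\ qap_t Q %| qap_num a.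

Definition qap_h (F : fieldType) (Q : qap F)
    (a : 'rV[F]_((qap_l Q).+1 + qap_k Q)) : {poly F} :=
  qap_num a %/ qap_t Q.

(* A QAP that expresses R_PoA: [poa_pub] encodes the public data (instance and
   output commitment), [poa_wires] computes the other wires from the witness,
   and [poa_extract] reads the witness off those wires.  Without
   [poa_extract], soundness would say nothing, since every commitment opens
   with s = 0 for a suitable r. *)
Record poaQAP (pp : pubParams) := PoaQAP {
  poa_qap :> qap 'F_(pp_p pp);
  poa_pub : instance pp -> pp -> 'rV['F_(pp_p pp)]_(qap_l poa_qap).+1;
  poa_wires : instance pp -> witness pp -> 'rV['F_(pp_p pp)]_(qap_k poa_qap);
  poa_extract : 'rV['F_(pp_p pp)]_(qap_k poa_qap) -> witness pp;
  poa_pub_inj : forall z z' c c', wf_instance z -> wf_instance z' ->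
    poa_pub z c = poa_pub z' c' -> z = z' /\ c = c';
  poa_complete : forall z w c, wf_instance z -> R_PoA z w c ->
    qap_valid (row_mx (poa_pub z c) (poa_wires z w)) /\
    poa_extract (poa_wires z w) = w;
  poa_sound : forall z c d, wf_instance z ->
    qap_valid (row_mx (poa_pub z c) d) -> R_PoA z (poa_extract d) c }.

(** * The ZK-SNARK *)

(* [bg_enc1], [bg_enc2] are the bit-string representations of group elements
   and [bg_desc] is a public description of the three groups and the pairing. *)
Record bilinearGroup (p : nat) := BilinearGroup {
  bg_G1 : finZmodType;
  bg_G2 : finZmodType;
  bg_GT : finZmodType;
  bg_card1 : #|bg_G1| = p;
  bg_card2 : #|bg_G2| = p;
  bg_cardT : #|bg_GT| = p;
  bg_g1 : bg_G1;
  bg_g2 : bg_G2;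
  bg_g1_gen : is_generator bg_g1;
  bg_g2_gen : is_generator bg_g2;
  bg_e : bg_G1 -> bg_G2 -> bg_GT;
  bg_eDl : forall a a' b, bg_e (a + a') b = bg_e a b + bg_e a' b;
  bg_eDr : forall a b b', bg_e a (b + b') = bg_e a b + bg_e a b';
  bg_e_nondeg : bg_e bg_g1 bg_g2 != 0;
  bg_enc1 : bg_G1 -> seq bool;
  bg_enc2 : bg_G2 -> seq bool;
  bg_enc1_inj : injective bg_enc1;
  bg_enc2_inj : injective bg_enc2;
  bg_desc : seq bool }.

Definition in_G1 (p : nat) (B : bilinearGroup p) (a : 'F_p) : bg_G1 B :=
  bg_g1 B *+ a.
Definition in_G2 (p : nat) (B : bilinearGroup p) (a : 'F_p) : bg_G2 B :=
  bg_g2 B *+ a.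

Record trapdoor (F : fieldType) := Trapdoor {
  td_alpha : F; td_beta : F; td_gamma : F; td_delta : F; td_x : F }.

Definition Fstar (p : nat) : {pred 'F_p} := [pred a | a != 0].

Definition sample_trapdoor (R : realType) (p : nat) :
    fdist R (trapdoor 'F_p) :=
  alpha <~ dunif R (@Fstar p) ;;
  beta <~ dunif R (@Fstar p) ;;
  gamma <~ dunif R (@Fstar p) ;;
  delta <~ dunif R (@Fstar p) ;;
  x <~ dunif R (@Fstar p) ;;
  dret R (Trapdoor alpha beta gamma delta x).

Section Groth.
Variables (F : fieldType) (Q : qap F) (td : trapdoor F).
Let alpha := td_alpha td.
Let beta := td_beta td.
Let gamma := td_gamma td.
Let delta := td_delta td.
Let x := td_x td.
Let N := qap_N Q.
Let l := qap_l Q.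
Let k := qap_k Q.

Definition groth_L (j : 'I_(l.+1 + k)) : F :=
  beta * (qap_u j).[x] + alpha * (qap_v j).[x] + (qap_w j).[x].

Definition groth_sigma1 : seq F :=
  [:: alpha; beta; delta]
  ++ [seq x ^+ j | j <- iota 0 N]
  ++ [seq groth_L (lshift k j) / gamma | j <- enum 'I_l.+1]
  ++ [seq groth_L (rshift l.+1 j) / delta | j <- enum 'I_k]
  ++ [seq x ^+ j * (qap_t Q).[x] / delta | j <- iota 0 N.-1].

Definition groth_sigma2 : seq F :=
  [:: beta; gamma; delta] ++ [seq x ^+ j | j <- iota 0 N].

Definition groth_A (a : 'rV[F]_(l.+1 + k)) (rho : F) : F :=
  alpha + \sum_j a 0 j * (qap_u j).[x] + rho * delta.

Definition groth_B (a : 'rV[F]_(l.+1 + k)) (theta : F) : F :=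
  beta + \sum_j a 0 j * (qap_v j).[x] + theta * delta.

Definition groth_C (a : 'rV[F]_(l.+1 + k)) (rho theta : F) : F :=
  (\sum_(j < k) a 0 (rshift l.+1 j) * groth_L (rshift l.+1 j)
    + (qap_h a).[x] * (qap_t Q).[x]) / delta
  + groth_A a rho * theta + groth_B a theta * rho - rho * theta * delta.
End Groth.

Definition crs (p : nat) (B : bilinearGroup p) : Type :=
  (seq (bg_G1 B) * seq (bg_G2 B))%type.

Definition groth_crs (p : nat) (B : bilinearGroup p) (Q : qap 'F_p)
    (td : trapdoor 'F_p) : crs B :=
  (map (in_G1 B) (groth_sigma1 Q td), map (in_G2 B) (groth_sigma2 Q td)).

Definition snark_proof (p : nat) (B : bilinearGroup p) : Type :=
  (bg_G1 B * bg_G2 B * bg_G1 B)%type.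

Definition groth_prove (R : realType) (p : nat) (B : bilinearGroup p)
    (Q : qap 'F_p) (td : trapdoor 'F_p)
    (a : 'rV['F_p]_((qap_l Q).+1 + qap_k Q)) : fdist R (snark_proof B) :=
  rho <~ dunif R (@Fstar p) ;;
  theta <~ dunif R (@Fstar p) ;;
  dret R (in_G1 B (groth_A td a rho), in_G2 B (groth_B td a theta),
          in_G1 B (groth_C td a rho theta)).

(* With N = qap_N Q, sigma.1 starts with [alpha], [beta], [delta] and N powers
   of x, then come the elements of the public wires; sigma.2 starts with
   [beta], [gamma], [delta]. *)
Definition groth_verify (p : nat) (B : bilinearGroup p) (Q : qap 'F_p)
    (sigma : crs B) (a : 'rV['F_p]_(qap_l Q).+1) (pi : snark_proof B) : bool :=
  let: (A1, B2, C1) := pi in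
  bg_e A1 B2 ==
    bg_e sigma.1`_0 sigma.2`_0
    + \sum_(j < (qap_l Q).+1) bg_e sigma.1`_(3 + qap_N Q + j) sigma.2`_1 *+ a 0 j
    + bg_e C1 sigma.2`_2.

(** * The experiment *)

(* The anonymity set (y_i, v_i), i < n, with its balances, and the x-component of the witness
   that the exchange uses for the i-th address when it claims (b = true), resp.
   does not claim (b = false), to own it.  Everything may depend on the public
   parameters. *)
Record exchange := Exchange {
  ex_n : nat -> nat;
  ex_anon : forall (lam : nat) (pp : pubParams), (ex_n lam).-tuple (instance pp);
  ex_key : forall (lam : nat) (pp : pubParams),
    'I_(ex_n lam) -> bool -> 'I_(pp_q pp);
  ex_wf : forall lam pp i, wf_instance (tnth (ex_anon lam pp) i);
  ex_key_true : forall lam pp i,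
    pp_G pp *+ ex_key pp i true = (tnth (ex_anon lam pp) i).1;
  ex_key_false : forall lam pp i,
    pp_G pp *+ ex_key pp i false <> (tnth (ex_anon lam pp) i).1 }.

Definition enc_qap (p : nat) (Q : qap 'F_p) : seq (seq bool) :=
  let enc_poly (f : {poly 'F_p}) := enc_list (@enc_Fp p) f in
  let enc_polys f :=
    enc_list enc_poly [seq f j | j <- enum 'I_((qap_l Q).+1 + qap_k Q)] in
  [:: binary (qap_l Q), binary (qap_k Q), binary (qap_N Q) & enc_poly (qap_t Q)]
  ++ enc_polys (@qap_u _ Q) ++ enc_polys (@qap_v _ Q) ++ enc_polys (@qap_w _ Q).

(* Besides (z, c, pi) the distinguisher gets 1^lam and all the public data:
   the parameters, the QAP, the description of the bilinear groups, the common
   reference string, and the public wires. *)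
Definition enc_view (lam : nat) (pp : pubParams) (Q : poaQAP pp)
    (B : bilinearGroup (pp_p pp)) (sigma : crs B) (z : instance pp) (c : pp)
    (pi : snark_proof B) : seq symbol :=
  let: (A1, B2, C1) := pi in
  encode (unary lam :: enc_params pp ++ enc_qap Q
    ++ bg_desc B :: enc_list (fun g => [:: bg_enc1 g]) sigma.1
    ++ enc_list (fun g => [:: bg_enc2 g]) sigma.2
    ++ enc_point z.1 ++ binary z.2 :: enc_point c
    ++ enc_list (@enc_Fp (pp_p pp))
         [seq poa_pub Q z c 0 j | j <- enum 'I_(qap_l Q).+1]
    ++ [:: bg_enc1 A1; bg_enc2 B2; bg_enc1 C1]).

Definition AddressPrivacy (R : realType) (GenE : nat -> fdist R ecGroup)
    (Q : forall pp : pubParams, poaQAP pp)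
    (B : forall pp : pubParams, bilinearGroup (pp_p pp))
    (X : exchange) (D : pptm) (lam : nat) (i : 'I_(ex_n X lam)) :
    fdist R bool :=
  pp <~ genParams GenE lam ;;
  td <~ sample_trapdoor R (pp_p pp) ;;
  b <~ dunif R {: bool} ;;
  r <~ dunif R [pred r : 'I_(pp_q pp) | (0 < r)%N] ;;
  let z := tnth (ex_anon X lam pp) i in
  let c := pp_G pp *+ (b * z.2) + pp_H pp *+ r in
  let w := Witness (ex_key pp i b) b r in
  let a := row_mx (poa_pub (Q pp) z c) (poa_wires (Q pp) z w) in
  pi <~ groth_prove R (B pp) td a ;;
  out <~ ppt_exec R D
           (enc_view lam (Q pp) (groth_crs (B pp) (Q pp) td) z c pi) ;;
  dret R ((out == [:: true]) == b).

(* Main.v *)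
(* Privacy is statistical.  By the verification equation C is a function of
   (c, A, B), and (r, rho, theta) |-> (c, A, B) is injective when delta != 0, for
   either value of the secret bit.  The triples are uniform on a set of size
   M = (q-1)(p-1)^2, so every distinguisher wins with probability at most
   q p^2 / (2M).  As the curve has at most 3p points, this is at most
   1/2 + 19/q.  The discrete logarithm assumption enters only through the
   average of 1/q, the success probability of a machine whose guess does not
   depend on the challenge. *)

Require Import Defs.
From mathcomp Require Import all_boot all_order all_algebra.
From mathcomp Require Import reals.
From mathcomp Require Import zify ring lra.
Import Order.TTheory GRing.Theory Num.Theory.
Local Open Scope ring_scope.

Set Implicit Arguments.
Unset Strict Implicit.
Unset Printing Implicit Defensive.

(** * Subdistributions and negligible functions *)

Section FiniteDistributions.
Variable R : realType.

(** The mass may be below 1: [dunif] on an empty predicate is the empty list. *)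
Definition is_subdist (T : Type) (d : fdist R T) : Prop :=
  all (fun wx => 0 <= wx.1) d /\ \sum_(wx <- d) wx.1 <= 1.

Lemma big_dbind (T U : Type) (d : fdist R T) (f : T -> fdist R U)
    (F : U -> R) :
  \sum_(wy <- dbind d f) wy.1 * F wy.2 =
  \sum_(wx <- d) wx.1 * \sum_(wy <- f wx.2) wy.1 * F wy.2.
Proof.
rewrite /dbind big_allpairs_dep /=; apply: eq_bigr => wx _.
by rewrite mulr_sumr; apply: eq_bigr => wy _; rewrite mulrA.
Qed.

Lemma PrE (T : Type) (d : fdist R T) (P : pred T) :
  Pr d P = \sum_(wx <- d) wx.1 * (P wx.2)%:R.
Proof.
rewrite /Pr big_mkcond /=; apply: eq_bigr => wx _.
by case: (P _); rewrite (mulr1, mulr0).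
Qed.

Lemma Pr_bind (T U : Type) (d : fdist R T) (f : T -> fdist R U) (P : pred U) :
  Pr (dbind d f) P = \sum_(wx <- d) wx.1 * Pr (f wx.2) P.
Proof.
rewrite PrE (big_dbind d f (fun y => (P y)%:R)).
by apply: eq_bigr => wx _; rewrite PrE.
Qed.

Lemma big_dunif (T : finType) (A : {pred T}) (F : T -> R) :
  \sum_(wx <- dunif R A) wx.1 * F wx.2 = #|A|%:R^-1 * \sum_(x in A) F x.
Proof.
rewrite /dunif big_map /= big_enum_cond /= mulr_sumr.
by apply: eq_bigl => x; rewrite andbT.
Qed.

Lemma Pr_bind_dunif (T : finType) (U : Type) (A : {pred T})
    (f : T -> fdist R U) (P : pred U) :
  Pr (dbind (dunif R A) f) P = #|A|%:R^-1 * \sum_(x in A) Pr (f x) P.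
Proof. by rewrite Pr_bind (big_dunif A (fun x => Pr (f x) P)). Qed.

Lemma Pr_dret (T : Type) (x : T) (P : pred T) : Pr (dret R x) P = (P x)%:R.
Proof. by rewrite PrE big_seq1 mul1r. Qed.

Lemma Pr_bind_assoc (T U V : Type) (d : fdist R T) (f : T -> fdist R U)
    (g : U -> fdist R V) (P : pred V) :
  Pr (dbind (dbind d f) g) P = Pr (dbind d (fun x => dbind (f x) g)) P.
Proof.
rewrite !Pr_bind (big_dbind d f (fun y => Pr (g y) P)).
by apply: eq_bigr => wx _; rewrite Pr_bind.
Qed.

Lemma Pr_dret_bind (T U : Type) (x : T) (f : T -> fdist R U) (P : pred U) :
  Pr (dbind (dret R x) f) P = Pr (f x) P.
Proof. by rewrite Pr_bind big_seq1 mul1r. Qed.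

Lemma subdist_dret (T : Type) (x : T) : is_subdist (dret R x).
Proof. by split; rewrite /= ?ler01 // big_seq1. Qed.

Lemma subdist_dunif (T : finType) (A : {pred T}) : is_subdist (dunif R A).
Proof.
split; first by rewrite all_map; apply/allP => x _ /=; rewrite invr_ge0 ler0n.
have := big_dunif A (fun=> 1); under eq_bigr do rewrite mulr1.
move=> ->; rewrite sumr_const.
have [->|A0] := eqVneq #|A| 0%N; first by rewrite mulr0n mulr0 ler01.
by rewrite mulVf // pnatr_eq0.
Qed.

Lemma ler_subdist (T : Type) (d : fdist R T) (F G : T -> R) :
  is_subdist d -> (forall x, F x <= G x) ->
  \sum_(wx <- d) wx.1 * F wx.2 <= \sum_(wx <- d) wx.1 * G wx.2.
Proof.
move=> [d0 _] FG; elim: d d0 => [|wx d IH] /=; first by rewrite !big_nil.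
by move=> /andP[w0 /IH{}IH]; rewrite !big_cons lerD // ler_wpM2l.
Qed.

Lemma Pr_bind_le (T U : Type) (d : fdist R T) (f : T -> fdist R U)
    (P : pred U) (G : T -> R) :
  is_subdist d -> (forall x, Pr (f x) P <= G x) ->
  Pr (dbind d f) P <= \sum_(wx <- d) wx.1 * G wx.2.
Proof.
by move=> sd fG; rewrite Pr_bind (ler_subdist (F := fun x => Pr (f x) P) sd fG).
Qed.

Lemma subdist_le_cst (T : Type) (d : fdist R T) (c : R) :
  is_subdist d -> 0 <= c -> \sum_(wx <- d) wx.1 * c <= c.
Proof. by move=> [_ d1] c0; rewrite -mulr_suml ler_piMl. Qed.

Lemma subdist_bind (T U : Type) (d : fdist R T) (f : T -> fdist R U) :
  is_subdist d -> (forall x, is_subdist (f x)) -> is_subdist (dbind d f).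
Proof.
move=> sd sf; split.
  case: sd => d0 _; rewrite /dbind; elim: d d0 => //= wx d IH /andP[w0 /IH{}IH].
  rewrite all_cat IH andbT all_map; case: (sf wx.2) => + _.
  by apply: sub_all => wy /= ?; rewrite mulr_ge0.
have := big_dbind d f (fun=> 1); under eq_bigr do rewrite mulr1.
move=> ->; apply: le_trans (subdist_le_cst sd ler01).
apply: (ler_subdist (F := fun x => \sum_(wy <- f x) wy.1 * 1) (G := fun=> 1)) => // x.
exact: subdist_le_cst.
Qed.

Lemma Pr_ge0 (T : Type) (d : fdist R T) (P : pred T) :
  is_subdist d -> 0 <= Pr d P.
Proof.
move=> sd; rewrite PrE.
have := @ler_subdist _ d (fun=> 0) (fun x => (P x)%:R) sd (fun x => ler0n _ _).
by rewrite big1 // => wx _; rewrite mulr0.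
Qed.

Lemma Pr_predC_le1 (T : Type) (d : fdist R T) (P : pred T) :
  is_subdist d -> Pr d P + Pr d (predC P) <= 1.
Proof.
move=> [_ d1]; rewrite !PrE -big_split; apply: le_trans d1.
rewrite le_eqVlt; apply/orP; left; apply/eqP; apply: eq_bigr => wx _ /=.
by case: (P _); rewrite !(mulr1, mulr0, addr0, add0r).
Qed.

Lemma Pr_bind_dunif_le (T : finType) (U : Type) (A : {pred T})
    (f : T -> fdist R U) (P : pred U) (c : R) :
  0 <= c -> (forall x, x \in A -> Pr (f x) P <= c) ->
  Pr (dbind (dunif R A) f) P <= c.
Proof.
move=> c0 fc; rewrite Pr_bind_dunif.
apply: (@le_trans _ _ (#|A|%:R^-1 * \sum_(x in A) c)).
  by rewrite ler_wpM2l ?invr_ge0 ?ler0n // ler_sum.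
rewrite -(big_dunif A (fun=> c)); apply: subdist_le_cst => //.
exact: subdist_dunif.
Qed.

Lemma subdist_ppt_exec (M : pptm) (w : seq symbol) :
  is_subdist (ppt_exec R M w).
Proof.
by apply: subdist_bind => [|x]; [exact: subdist_dunif|exact: subdist_dret].
Qed.

Lemma subdist_genParams (GenE : nat -> fdist R ecGroup) (lam : nat) :
  is_dist (GenE lam) -> is_subdist (genParams GenE lam).
Proof.
move=> [d0 d1]; apply: subdist_bind => [|E]; first by rewrite /is_subdist d1.
apply: subdist_bind => [|G]; first exact: subdist_dunif.
by apply: subdist_bind => [|H]; [exact: subdist_dunif|exact: subdist_dret].
Qed.

(** Smallness against the exponent [c.+1] leaves a spare factor [n], which absorbs [k] once [n]
    exceeds it. *)
Lemma negligible_scale (f : nat -> R) (k : nat) :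
  negligible f -> negligible (fun n => k%:R * f n).
Proof.
move=> nf c; have [n0 fn0] := nf c.+1; exists (maxn n0 k.+1) => n.
rewrite geq_max => /andP[/fn0 fn kn].
have n_gt0 : 0 < n%:R :> R by rewrite ltr0n; apply: leq_ltn_trans kn.
rewrite normrM normr_nat; apply: (@le_lt_trans _ _ (n%:R * `|f n|)).
  by rewrite ler_wpM2r // ler_nat ltnW.
by rewrite -ltr_pdivlMl // mulrC -invfM -exprSr.
Qed.

(* Two injections into [T] reach each point at most once each, so the
   strategies for b = true and b = false share the total mass of [T]. *)
Lemma guess_sum_le (J T : finType) (A : {pred J}) (f : bool -> J -> T)
    (h : bool -> T -> R) :
  (forall b, {in A &, injective (f b)}) ->
  (forall b t, 0 <= h b t) -> (forall t, h true t + h false t <= 1) ->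
  \sum_(b : bool) \sum_(j in A) h b (f b j) <= #|T|%:R.
Proof.
move=> f_inj h0 h1.
have part b : \sum_(j in A) h b (f b j) <= \sum_t h b t.
  (* By injectivity this is a sum over the image of [f b]; nonnegativity extends it to all of
     [T]. *)
  rewrite -(big_imset (fun t => h b t) (f_inj b)) /=.
  rewrite [leRHS](bigID [in f b @: A]) /=.
  by rewrite lerDl sumr_ge0.
rewrite big_bool /=; apply: le_trans (lerD (part true) (part false)) _.
rewrite -big_split /= -sum1_card natr_sum.
by apply: ler_sum => t _; exact: h1.
Qed.

End FiniteDistributions.

(** * Order of the curve group and the numerical bound *)

(** By counting: [#|E|] multiples cover [#|E|] points, so no two coincide. *)
Lemma generator_mulrn_inj (E : finZmodType) (P : E) :
  is_generator P -> injective (fun k : 'I_#|E| => P *+ k).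
Proof.
move=> /forallP gen; apply/injectiveP/card_uniqP.
rewrite size_map -cardT card_ord; apply: eq_card => X.
rewrite inE; have /existsP[k /eqP ->] := gen X.
by apply/mapP; exists k; rewrite ?mem_enum.
Qed.

(* Each abscissa carries at most two points. *)
Lemma ec_q_le (E : ecGroup) : (ec_q E <= 3 * ec_p E)%N.
Proof.
have pP := ec_p_prime E.
pose xc (P : E) := omap fst (ec_pt P).
suff fib o : (#|[pred P : E | xc P == o]| <= 2)%N.
  rewrite -(ec_card E) -sum1_card (partition_big xc predT) //=.
  apply: (@leq_trans (\sum_(o : option 'F_(ec_p E)) 2)).
    apply: leq_sum => o _; rewrite sum1_card.
    by apply: leq_trans (fib o); apply/eq_leq/eq_card.
  (* With the fibre of infinity there are [p + 1] fibres, and [2 * (p + 1)] is at most [3 * p] since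
     [p >= 2]. *)
  rewrite sum_nat_const card_option card_Fp //.
  by have := prime_gt1 pP; lia.
have [E0|[P0]] := set_0Vmem [set P : E | xc P == o].
  by rewrite -cardsE E0 cards0.
rewrite inE => /eqP xP0; rewrite -xP0 {o xP0}.
(* [alt] is the inverse of [P0] in coordinates. *)
pose alt := let: Weierstrass a1 _ a3 _ _ := ec_curve E in
  omap (fun xy => (xy.1, - (a1 * xy.1) - a3 - xy.2)) (ec_pt P0).
have opp P : xc P = xc P0 -> ec_pt P = ec_pt P0 \/ ec_pt P = alt.
  rewrite /xc /alt; have := ec_pt_curve P; have := ec_pt_curve P0.
  case: (ec_curve E) => a1 a2 a3 a4 a6.
  case: (ec_pt P0) => [[x0 y0]|]; last by case: (ec_pt P) => // _ _ _; left.
  case: (ec_pt P) => [[x y]|] //= /eqP e0 /eqP e [xE]; subst x0.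
  (* Subtracting the curve equations of two points with equal abscissa leaves this product. *)
  have /eqP : (y - y0) * (y - (- (a1 * x) - a3 - y0)) = 0.
    have -> : (y - y0) * (y - (- (a1 * x) - a3 - y0)) =
      (y ^+ 2 + a1 * x * y + a3 * y) - (y0 ^+ 2 + a1 * x * y0 + a3 * y0) by ring.
    by rewrite e e0 subrr.
  by rewrite mulf_eq0 !subr_eq0 => /orP[] /eqP ->; [left|right].
rewrite -(card_image (@ec_pt_inj E)).
apply: (@leq_trans #|[set ec_pt P0; alt]|); last by rewrite cards2; case: (_ == _).
apply/subset_leq_card/subsetP => o /imageP[P]; rewrite inE => /eqP /opp[] -> ->;
  by rewrite !inE eqxx ?orbT.
Qed.

Lemma guess_ratio_le (R : realType) (p q : R) :
  2 <= p -> 2 <= q -> q <= 3 * p ->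
  q * (p * p) / (2 * ((q - 1) * ((p - 1) * (p - 1)))) <= 1 / 2 + 19 * q^-1.
Proof.
move=> p2 q2 qp.
have c0 : 0 < 2 * ((q - 1) * ((p - 1) * (p - 1))) by rewrite !mulr_gt0 //; lra.
rewrite ler_pdivrMr //.
have q0 : 0 < q by lra.
rewrite -(ler_pM2l q0).
have -> : q * ((1 / 2 + 19 * q^-1) * (2 * ((q - 1) * ((p - 1) * (p - 1))))) =
  (q + 38) * ((q - 1) * ((p - 1) * (p - 1))).
  by field; rewrite gt_eqF.
(* The shift makes the variables nonnegative. The only negative terms of the difference are then -3
   v^2 and -2 u v^2; [h1] and [h2] use [v <= 3 u + 4] to trade away one factor [v]. *)
pose u := p - 2; pose v := q - 2.
have ->: p = u + 2 by rewrite /u; ring.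
have ->: q = v + 2 by rewrite /v; ring.
have u0 : 0 <= u by rewrite /u; lra.
have v0 : 0 <= v by rewrite /v; lra.
have h : 0 <= (3 * u + 4 - v) by rewrite /u /v; lra.
rewrite -subr_ge0.
have uv := mulr_ge0 u0 v0.
have uuv := mulr_ge0 u0 uv.
have uu := mulr_ge0 u0 u0.
have h1 := mulr_ge0 h v0.
have h2 := mulr_ge0 h uv.
nra.
Qed.

(** * Groth proof elements as functions of the randomness *)

(** The verification equation solved for C. Divisibility gives h(x)t(x) = UV - W for the evaluated
    wire combinations, and the terms in [rho] and [theta] are those of the product AB. Private wires
    and randomness thus enter C only through A and B. *)
Lemma groth_C_eq (F : fieldType) (Q : qap F) (td : trapdoor F)
    (c : 'rV[F]_(qap_l Q).+1) (d : 'rV[F]_(qap_k Q)) (rho theta : F) :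
  td_delta td != 0 -> qap_valid (row_mx c d) ->
  groth_C td (row_mx c d) rho theta =
  (groth_A td (row_mx c d) rho * groth_B td (row_mx c d) theta
   - td_alpha td * td_beta td
   - \sum_j c 0 j * groth_L td (lshift (qap_k Q) j)) / td_delta td.
Proof.
move=> d0 [_ /divpK].
set a := row_mx c d => ht; set x := td_x td.
pose ev (f : 'I_(_ + _) -> {poly F}) := \sum_j a 0 j * (f j).[x].
have evE f : (\sum_j a 0 j *: f j).[x] = ev f.
  by rewrite horner_sum; apply: eq_bigr => j _; rewrite hornerZ.
have hx : (qap_h a).[x] * (qap_t Q).[x] =
    ev (@qap_u _ Q) * ev (@qap_v _ Q) - ev (@qap_w _ Q).
  by rewrite -hornerM ht /qap_num !hornerE !evE.
have LE : \sum_j c 0 j * groth_L td (lshift (qap_k Q) j) +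
    \sum_j a 0 (rshift _ j) * groth_L td (rshift _ j) =
    td_beta td * ev (@qap_u _ Q) + td_alpha td * ev (@qap_v _ Q) + ev (@qap_w _ Q).
  rewrite !mulr_sumr -!big_split /= [RHS]big_split_ord /=.
  by congr (_ + _); apply: eq_bigr => j _; rewrite ?row_mxEl /groth_L -/x; ring.
rewrite /groth_C /groth_A /groth_B -/x hx.
have -> : \sum_j a 0 (rshift _ j) * groth_L td (rshift _ j) =
  td_beta td * ev (@qap_u _ Q) + td_alpha td * ev (@qap_v _ Q) + ev (@qap_w _ Q)
  - \sum_j c 0 j * groth_L td (lshift (qap_k Q) j) by rewrite -LE; ring.
by rewrite /ev; field.
Qed.

Lemma groth_A_inj (F : fieldType) (Q : qap F) (td : trapdoor F)
    (a : 'rV[F]_((qap_l Q).+1 + qap_k Q)) :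
  td_delta td != 0 -> injective (groth_A td a).
Proof. by move=> d0 rho rho' /addrI /(mulIf d0). Qed.

Lemma groth_B_inj (F : fieldType) (Q : qap F) (td : trapdoor F)
    (a : 'rV[F]_((qap_l Q).+1 + qap_k Q)) :
  td_delta td != 0 -> injective (groth_B td a).
Proof. by move=> d0 theta theta' /addrI /(mulIf d0). Qed.

Lemma card_Fstar (p : nat) : prime p -> #|@Fstar p| = (p - 1)%N.
Proof.
move=> pP; have := cardC1 (0 : 'F_p); rewrite card_Fp // subn1 => <-.
exact: eq_card.
Qed.

Lemma card_ord_gt0 (q : nat) : #|[pred r : 'I_q | (0 < r)%N]| = (q - 1)%N.
Proof.
case: q => [|q]; first by apply: eq_card0 => -[].
have := cardC1 (ord0 : 'I_q.+1); rewrite card_ord subn1 => <-.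
by apply: eq_card => r; rewrite !inE lt0n.
Qed.

Lemma is_generator_mulrn_inj (pp : pubParams) (P : pp) :
  is_generator P -> injective (fun k : 'I_(pp_q pp) => P *+ k).
Proof.
move=> gP k k' /= e; rewrite -(ec_card pp) in k k' e *.
exact: (generator_mulrn_inj gP).
Qed.

(** * The game for one address, with parameters and trapdoor fixed *)

Lemma AddressPrivacy_fixed_le (R : realType) (pp : pubParams) (Q : poaQAP pp)
    (B : bilinearGroup (pp_p pp)) (D : pptm) (lam : nat) (z : instance pp)
    (key : bool -> 'I_(pp_q pp)) (td : trapdoor 'F_(pp_p pp)) :
  wf_instance z -> pp_G pp *+ key true = z.1 -> pp_G pp *+ key false <> z.1 ->
  td_delta td != 0 ->
  Pr (b <~ dunif R {: bool} ;;
      r <~ dunif R [pred r : 'I_(pp_q pp) | (0 < r)%N] ;;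
      let c := pp_G pp *+ (b * z.2) + pp_H pp *+ r in
      let w := Witness (key b) b r in
      let a := row_mx (poa_pub Q z c) (poa_wires Q z w) in
      pi <~ groth_prove R B td a ;;
      out <~ ppt_exec R D (enc_view lam Q (groth_crs B Q td) z c pi) ;;
      dret R ((out == [:: true]) == b)) id
  <= 1 / 2 + 19%:R * (pp_q pp)%:R^-1.
Proof.
move=> wfz keyT keyF d0.
pose F := 'F_(pp_p pp).
pose cm (b : bool) (r : 'I_(pp_q pp)) : pp := pp_G pp *+ (b * z.2) + pp_H pp *+ r.
pose wit b (r : 'I_(pp_q pp)) := Witness (key b) b r.
pose asg (b : bool) r := row_mx (poa_pub Q z (cm b r)) (poa_wires Q z (wit b r)).
have valid b r : qap_valid (asg b r).
  (* The relation holds for either bit because [key true] is a private key of the address and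
     [key false] is not. *)
  suff Rw : R_PoA z (wit b r) (cm b r) by have [] := poa_complete Q wfz Rw.
  case: z keyT keyF @cm @asg {wfz} => y v /= keyT keyF.
  by case: b; split => //; [right|left].
(* [T] holds the triples (c, A, B) and [J] the randomness (r, rho, theta); [pi_of] rebuilds the
   proof from a triple. *)
pose T := (pp * (F * F))%type.
pose J := ('I_(pp_q pp) * (F * F))%type.
pose pi_of (t : T) : snark_proof B :=
  (in_G1 B t.2.1, in_G2 B t.2.2,
   in_G1 B ((t.2.1 * t.2.2 - td_alpha td * td_beta td
     - \sum_j poa_pub Q z t.1 0 j * groth_L td (lshift (qap_k Q) j))
     / td_delta td)).
pose f b (j : J) : T := (cm b j.1,
  (groth_A td (asg b j.1) j.2.1, groth_B td (asg b j.1) j.2.2)).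
pose exec t := ppt_exec R D (enc_view lam Q (groth_crs B Q td) z t.1 (pi_of t)).
pose h b t := Pr (exec t) (fun out => (out == [:: true]) == b).
pose A : {pred J} := [pred j : J | [&& (0 < j.1)%N, j.2.1 != 0 & j.2.2 != 0]].
(* [r] is recovered first, from the commitment, since A and B depend on it through the assignment;
   they are then affine in [rho] and [theta] with slope delta. *)
have f_inj b : {in A &, injective (f b)}.
  move=> [r [rho theta]] [r' [rho' theta']] _ _ e.
  have /addrI er := congr1 fst e.
  have := is_generator_mulrn_inj (valP (pp_Hgen pp)) er => /= {}er.
  have := congr1 (fun t : T => t.2.2) e; have := congr1 (fun t : T => t.2.1) e.
  by rewrite /f /= er => /(groth_A_inj d0) -> /(groth_B_inj d0) ->.
have p2 := prime_gt1 (ec_p_prime pp); have q2 := prime_gt1 (ec_q_prime pp).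
pose M : R := ((pp_q pp)%:R - 1) * (((pp_p pp)%:R - 1) * ((pp_p pp)%:R - 1)).
have sampleE b : Pr (r <~ dunif R [pred r : 'I_(pp_q pp) | (0 < r)%N] ;;
      pi <~ groth_prove R B td (asg b r) ;;
      out <~ ppt_exec R D
               (enc_view lam Q (groth_crs B Q td) z (cm b r) pi) ;;
      dret R ((out == [:: true]) == b)) id =
    M^-1 * \sum_(j in A) h b (f b j).
  have -> : M^-1 = #|[pred r : 'I_(pp_q pp) | (0 < r)%N]|%:R^-1 *
      (#|@Fstar (pp_p pp)|%:R^-1 * #|@Fstar (pp_p pp)|%:R^-1).
    rewrite /M !invfM; congr (_^-1 * (_^-1 * _^-1)).
    - by rewrite card_ord_gt0 natrB // ltnW.
    - by rewrite card_Fstar ?natrB ?(ec_p_prime pp) //; exact: ltnW.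
    - by rewrite card_Fstar ?natrB ?(ec_p_prime pp) //; exact: ltnW.
  rewrite Pr_bind_dunif -!mulrA; congr (_ * _).
  transitivity (\sum_(r in [pred r : 'I_(pp_q pp) | (0 < r)%N])
      #|@Fstar (pp_p pp)|%:R^-1 * (\sum_(rho in @Fstar (pp_p pp))
      #|@Fstar (pp_p pp)|%:R^-1 * (\sum_(theta in @Fstar (pp_p pp))
      h b (f b (r, (rho, theta)))))).
    apply: eq_bigr => r _.
    rewrite Pr_bind_assoc Pr_bind_dunif; congr (_ * _); apply: eq_bigr => rho _.
    rewrite Pr_bind_assoc Pr_bind_dunif; congr (_ * _); apply: eq_bigr => theta _.
    rewrite Pr_dret_bind; cbv beta.
    (* With C rewritten, the proof is [pi_of] of the triple, so the view depends on the randomness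
       only through that triple. *)
    rewrite (groth_C_eq _ _ d0 (valid b r)) Pr_bind /h [RHS]PrE.
    by apply: eq_bigr => wx _; rewrite Pr_dret.
  rewrite -mulr_sumr; congr (_ * _).
  under eq_bigr do rewrite -mulr_sumr.
  rewrite -mulr_sumr; congr (_ * _).
  under eq_bigr do rewrite pair_big /=.
  by rewrite pair_big /=; apply: eq_big => [[r [rho theta]]|[r [rho theta]] _].
have h0 b t : 0 <= h b t by apply: Pr_ge0; exact: subdist_ppt_exec.
have h1 t : h true t + h false t <= 1.
  (* Every output other than [[:: true]] counts as the guess false, so the two events are
     complementary. *)
  pose win (out : seq bool) := (out == [:: true]) == true.
  have := Pr_predC_le1 win
    (subdist_ppt_exec R D (enc_view lam Q (groth_crs B Q td) z t.1 (pi_of t))).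
  congr (_ + _ <= _); apply: eq_bigl => wx; rewrite /= /win.
  by case: (_ == [:: true]).
have := guess_sum_le f_inj h0 h1.
have -> : #|{: T}| = (pp_q pp * (pp_p pp * pp_p pp))%N.
  by rewrite !card_prod (ec_card pp) card_Fp // ec_p_prime.
move=> hT.
have p2R : 2 <= (pp_p pp)%:R :> R by rewrite ler_nat.
have q2R : 2 <= (pp_q pp)%:R :> R by rewrite ler_nat.
have M0 : 0 < M by rewrite /M !mulr_gt0 //; lra.
have qpR : (pp_q pp)%:R <= 3 * (pp_p pp)%:R :> R.
  by rewrite -natrM ler_nat; exact: ec_q_le.
apply: le_trans (guess_ratio_le p2R q2R qpR).
(* The fair bit contributes 1/2, so the common factor is [(2 * M)^-1] and [hT] remains. *)
rewrite Pr_bind_dunif card_bool (eq_bigr _ (fun b _ => sampleE b)) -mulr_sumr.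
have iM0 : 0 < (2 * M)^-1 by rewrite invr_gt0 mulr_gt0.
rewrite [leLHS]mulrA -[2%:R^-1 * M^-1]invfM [leLHS]mulrC ler_pM2r //.
by rewrite -!natrM.
Qed.

(** * A challenge-independent discrete logarithm guesser *)

Definition idle_ptm : ptm :=
  @Ptm unit tt predT (fun _ _ _ => (tt, Blank, Stay)).

Lemma idle_halts (w : seq symbol) (coins : (size w ^ 0 + 0).-tuple bool) :
  ptm_halted (cfg_state (ptm_run (ptm_init idle_ptm w) coins)).
Proof. by []. Qed.

Definition idle_pptm : pptm := Pptm idle_halts.

(** The machine halts at once with its input on the tape, and the output stops at the first [Sep];
    for [n = 0] the head already rests on it. *)
Lemma idle_output (n : nat) (fields : seq (seq bool)) (coins : seq bool) :
  ptm_output (ptm_run (ptm_init idle_pptm (encode (unary n :: fields))) coins)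
  = unary n.
Proof.
have -> : ptm_run (ptm_init idle_pptm (encode (unary n :: fields))) coins =
  ptm_init idle_pptm (encode (unary n :: fields)) by case: coins.
rewrite /encode /= cat_rcons; case: n => //= n; congr cons.
by elim: n => //= n ->.
Qed.

(** For given parameters the guess names one fixed point, which is one of [q] equally likely
    challenges. *)
Lemma DL_idle (R : realType) (GenE : nat -> fdist R ecGroup) (lam : nat) :
  Pr (DL_experiment GenE idle_pptm lam) id =
  \sum_(wp <- genParams GenE lam) wp.1 * (pp_q wp.2)%:R^-1.
Proof.
rewrite Pr_bind; apply: eq_bigr => -[w pp] _ /=; congr (_ * _).
rewrite Pr_bind_dunif.
have outE Y : Pr (out <~ ppt_exec R idle_pptm
        (encode (unary lam :: enc_params pp ++ enc_point Y)) ;;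
      dret R (Y == pp_G pp *+ of_binary out)) id =
    (Y == pp_G pp *+ of_binary (unary lam))%:R.
  rewrite Pr_bind_assoc Pr_bind_dunif.
  under eq_bigr do rewrite Pr_dret_bind Pr_dret idle_output.
  rewrite sumr_const -[X in _ * X = _]mulr_natl mulrA.
  by rewrite mulVf ?mul1r // card_tuple card_bool pnatr_eq0 expn_eq0.
rewrite (eq_bigr _ (fun Y _ => outE Y)).
rewrite (bigD1 (pp_G pp *+ of_binary (unary lam))) //= eqxx.
rewrite big1 => [|Y /negPf -> //].
by rewrite addr0 mulr1 (ec_card pp).
Qed.

(** * Averaging over trapdoor and parameters *)

(** All five draws are from [Fstar]; that of delta supplies [td_delta td != 0], on which injectivity
    in the randomness rests. *)
Lemma Pr_sample_trapdoor_le (R : realType) (p : nat) (U : Type)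
    (f : trapdoor 'F_p -> fdist R U) (P : pred U) (c : R) :
  0 <= c -> (forall td, td_delta td != 0 -> Pr (f td) P <= c) ->
  Pr (dbind (sample_trapdoor R p) f) P <= c.
Proof.
move=> c0 fc; rewrite /sample_trapdoor.
do 5![rewrite Pr_bind_assoc; apply: Pr_bind_dunif_le => // ? ?].
by rewrite Pr_dret_bind fc.
Qed.

Theorem mainTheorem1 (R : realType)
  (GenE : nat -> fdist R ecGroup)
  (GenE_dist : forall lam : nat, is_dist (GenE lam))
  (DL : DL_hard GenE)
  (Q : forall pp : pubParams, poaQAP pp)
  (B : forall pp : pubParams, bilinearGroup (pp_p pp))
  (X : exchange)
  (D : pptm) :
  exists negl : nat -> R,
    negligible negl /\
    forall (lam : nat) (i : 'I_(ex_n X lam)),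
      Pr (AddressPrivacy GenE Q B D i) id <= 1 / 2 + negl lam.
Proof.
(* The factor 19 is that of [guess_ratio_le]. *)
exists (fun lam => 19%:R * Pr (DL_experiment GenE idle_pptm lam) id).
split; first exact/negligible_scale/DL.
move=> lam i; rewrite DL_idle.
have sd := subdist_genParams (GenE_dist lam).
pose bound (pp : pubParams) : R := 1 / 2 + 19%:R * (pp_q pp)%:R^-1.
have b0 pp : 0 <= bound pp by rewrite addr_ge0 ?mulr_ge0 ?invr_ge0 ?ler0n.
apply: (@le_trans _ _ (\sum_(wp <- genParams GenE lam) wp.1 * bound wp.2)).
  apply: Pr_bind_le => // pp; apply: Pr_sample_trapdoor_le => // td d0.
  exact: (AddressPrivacy_fixed_le R (Q pp) (B pp) D lam (@ex_wf X lam pp i)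
    (@ex_key_true X lam pp i) (@ex_key_false X lam pp i) d0).
(* The constant 1/2 survives averaging since the mass is at most 1; the rest averages to exactly 19
   times the success probability of the idle machine. *)
rewrite /bound; under eq_bigr do rewrite mulrDr.
rewrite big_split /= lerD //; first by apply: subdist_le_cst => //; lra.
rewrite mulr_sumr le_eqVlt; apply/orP; left; apply/eqP.
by apply: eq_bigr => wp _; ring.
Qed.
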